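(* Consider the Markov-modeled downlink described in the context (with $p>r$) with $N=2$ users and deterministic ARQ delay of $D=d$ slots, $d\ge0$, and let $\mathcal{C}\subseteq\mathbb{R}^2$ be its capacity region. Let $p_s=\frac{r}{1-(p-r)}$ and $$O=(0,0),\quad X_1=(p_s,0),\quad X_2=(0,p_s),$$ $$Z_1=\big(p_sT^d(p)+(1-p_s)^2T^d(r),\ (1-p_s)p_sT^d(p)\big),$$ $$Z_2=\big((1-p_s)p_sT^d(p),\ p_sT^d(p)+(1-p_s)^2T^d(r)\big).$$ An outer bound on the capacity region is given by the set of points $(x_1,x_2)\notin H_{\mathrm{convex}}(O,X_1,Z_1,Z_2,X_2)$, i.e. no such point is achievable: $\mathcal{C}\subseteq H_{\mathrm{convex}}(O,X_1,Z_1,Z_2,X_2)$. An inner bound is given by $$H_{\mathrm{convex}}(O,X_1,Y_{1,2},X_2)\subseteq\mathcal{C},\qquad Y_{1,2}=\Big(\tfrac{C_{\mathrm{sum}}(2)}{2},\tfrac{C_{\mathrm{sum}}(2)}{2}\Big),$$ with $C_{\mathrm{sum}}(2)=p_sT^d(p)+(1-p_s)p_s$, the sum capacity of the system.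
   Context: Model. There are $N=2$ users. Time is slotted and slots are indexed in DEcreasing order $m,m-1,\ldots,1$, where $m$ is the horizon (slot $m$ is first, slot $1$ is last). The channel state of user $i$ in slot $t$ is $S_t(i)\in\{0,1\}$ ($1$ = ON, $0$ = OFF). The channels are independent across users, and each is a Markov chain with $P(S_t(i)=1\mid S_{t+1}(i)=1)=p$ and $P(S_t(i)=1\mid S_{t+1}(i)=0)=r$, with $p,r\in[0,1]$, $p>r$ and $p+(1-r)<2$; the initial distribution is the stationary one, $P(S_m(i)=1)=p_s$. Scheduling and feedback. In each slot $t$ the scheduler, not knowing the channel states, schedules one user $a_t\in\{1,2\}$. The scheduled user generates the ARQ feedback bit $f_t=S_t(a_t)$, which arrives, without error and stamped with its originating slot, at the end of slot $t-d$ (delay $0$ means it arrives at the end of slot $t$ itself). Write $T(x)=xp+(1-x)r$, $T^0(x)=x$, $T^u=T\circ T^{u-1}$. Policies and throughput. The belief $\pi_k(i)$ is the conditional probability that user $i$'s channel is ON in slot $k$ given all feedback arrived by the beginning of slot $k$. A scheduling policy $\mathfrak{A}$ chooses $a_k$ in each slot $k$ on the basis of the information available to the scheduler (arrived time-stamped feedback and past decisions); time sharing between policies, and idling (scheduling no user) in a slot, are allowed. The throughput of user $i$ under $\mathfrak{A}$ is $$\mu_i^{\mathfrak{A}}=\lim_{m\to\infty}\frac{E\big[\sum_{k=1}^m \pi_k(a_k)\,\mathbf{1}\{a_k=i\}\big]}{m}.$$ The capacity region is $\mathcal{C}=\bigcup_{\mathfrak{A}}\{(\mu_1^{\mathfrak{A}},\mu_2^{\mathfrak{A}})\}$,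 the union over all scheduling policies. The sum capacity is the maximum over policies of $\lim_{m\to\infty}\frac1m E[\sum_{k=1}^m\pi_k(a_k)]$. $H_{\mathrm{convex}}$ denotes the convex hull of a finite set of points. *)

(* Defs.v *)
From HB Require Import structures.
From mathcomp Require Import all_boot all_order all_algebra.
From mathcomp Require Import boolp classical_sets functions.
From mathcomp Require Import reals topology normedtype convex.

Set Implicit Arguments.
Unset Strict Implicit.
Unset Printing Implicit Defensive.

Import Order.TTheory GRing.Theory Num.Theory.
Import numFieldNormedType.Exports.

Local Open Scope classical_set_scope.
Local Open Scope ring_scope.

(** Time is slotted and runs downwards: over a horizon [m], the ordinal
    [k : 'I_m] stands for slot [k + 1]: the first slot has value [m.-1], the last
    one value [0], and [k < t] means that slot [t] precedes slot [k].
    Users are [0, 1 : 'I_2] (users 1 and 2); a decision is [Some i] (schedule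
    user [i]) or [None] (idle). *)

Definition hull (R : realType) (s : seq (R * R)) : set (R * R) :=
  smallest (@convex_set R (R * R)%type) [set` s].

Section Downlink.
Variable R : realType.

Section Channel.
Variables p r : R.

Definition Tmap (x : R) : R := x * p + (1 - x) * r.

Definition Tpow (u : nat) (x : R) : R := iter u Tmap x.

Definition p_s : R := r / (1 - (p - r)).

Definition bernoulli_mass (q : R) (b : bool) : R := if b then q else 1 - q.

Definition channel_states (m : nat) := {ffun 'I_m -> {ffun 'I_2 -> bool}}.

(* The factor of slot [k] is the transition from the preceding slot [k.+1],
   or the stationary distribution when [k] is the first slot. *)
Definition chain_law (m : nat) (c : 'I_m -> bool) : R :=
  \prod_(k < m)
    bernoulli_mass (if insub k.+1 is Some t then if c t then p else r else p_s)
                   (c k).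

Definition channel_law (m : nat) (S : channel_states m) : R :=
  \prod_(i < 2) chain_law (fun t => S t i).

End Channel.

Definition decisions (m : nat) := {ffun 'I_m -> option 'I_2}.

(* At each originating slot: no feedback, or the scheduled user and its ARQ
   bit. *)
Definition feedback_record (m : nat) := {ffun 'I_m -> option ('I_2 * bool)}.

Definition trajectory (m : nat) := (channel_states m * decisions m)%type.

Section Information.
Variables (m : nat) (k : 'I_m) (w : trajectory m).

(* With delay [d], the feedback of slot [t] arrives at the end of slot [t - d],
   hence before the beginning of slot [k] iff [k < t - d]. *)
Definition arrived (d : nat) : feedback_record m :=
  [ffun t : 'I_m => if (k + d < t)%N then omap (fun i => (i, w.1 t i)) (w.2 t)
                    else None].

Definition past_decisions : decisions m :=
  [ffun t : 'I_m => if (k < t)%N then w.2 t else None].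

End Information.

(** [decide A m k F a x] is the probability that, over horizon [m], the policy
    [A] takes decision [x] in slot [k] when the arrived time-stamped feedback is
    [F] and the past decisions are [a]. Deterministic policies are the 0/1-valued
    ones. The rule may depend on [k] and [m] and may randomize, so both time
    sharing over slots and time sharing by a random choice between policies are
    policies. *)
Record policy := Policy {
  decide : forall m : nat, 'I_m -> feedback_record m -> decisions m ->
           option 'I_2 -> R;
  decide_ge0 : forall m (k : 'I_m) F a x, 0 <= decide k F a x;
  decide_sum1 : forall m (k : 'I_m) F a, \sum_x decide k F a x = 1 }.

Section Throughput.
Variables (p r : R) (d : nat) (A : policy).

Definition law (m : nat) (w : trajectory m) : R :=
  channel_law p r w.1 *
  \prod_(k < m) decide A k (arrived k w d) (past_decisions k w) (w.2 k).

Definition Prob (m : nat) (E : pred (trajectory m)) : R :=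
  \sum_(w | E w) law w.

Definition Expect (m : nat) (X : trajectory m -> R) : R :=
  \sum_w law w * X w.

(* The conditional probability that user [i] is ON in slot [k] given that the
   feedback arrived by the beginning of slot [k] is the one observed in [w]. *)
Definition belief (m : nat) (k : 'I_m) (i : 'I_2) (w : trajectory m) : R :=
  Prob [pred v : trajectory m | v.1 k i & arrived k v d == arrived k w d] /
  Prob [pred v : trajectory m | arrived k v d == arrived k w d].

Definition user_rate (i : 'I_2) (m : nat) : R :=
  Expect (fun w : trajectory m => \sum_(k < m | w.2 k == Some i) belief k i w)
  / m%:R.

Definition sum_rate (m : nat) : R :=
  Expect (fun w : trajectory m =>
    \sum_(k < m) if w.2 k is Some i then belief k i w else 0) / m%:R.

Definition is_throughput (i : 'I_2) (mu : R) : Prop :=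
  user_rate i m @[m --> \oo] --> mu.

Definition is_sum_throughput (mu : R) : Prop :=
  sum_rate m @[m --> \oo] --> mu.

End Throughput.

Definition capacity_region (p r : R) (d : nat) : set (R * R) :=
  [set x | exists A : policy, is_throughput p r d A 0 x.1 /\
                              is_throughput p r d A 1 x.2].

Definition is_sum_capacity (p r : R) (d : nat) (c : R) : Prop :=
  (exists A : policy, is_sum_throughput p r d A c) /\
  (forall (A : policy) (c' : R), is_sum_throughput p r d A c' -> c' <= c).

End Downlink.

(* Main.v *)
(** By conditional independence of decisions and channels given the arrived
    feedback, the rate of user [i] in slot [k] is the probability of scheduling
    [i] in slot [k] while its channel is ON.

    Outer bound: a genie revealing both states in slot [K = k + d + 1] turns
    the weighted rate in slot [k] into a maximum of [c_i T^d(p)] or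
    [c_i T^d(r)] over the users.  The weights [(1, 1)], [(T^d(p), T^d(r))] and
    [(T^d(r), T^d(p))] give the three edges Z1Z2, X1Z1 and Z2X2.

    Sum capacity: let slot [k] repeat the user of slot [K] if it was ON and
    switch otherwise.  This is already the choice of the genie, since after a
    switch the other user is the best choice whatever its state was.  Started
    from a fair coin, this policy is symmetric in the two users, so each of
    them gets half of the sum.  Using it in a fraction of the slots and a
    random choice of user in the others yields the inner bound. *)

Require Import Defs.
From HB Require Import structures.
From mathcomp Require Import all_boot all_order all_algebra.
From mathcomp Require Import boolp classical_sets functions.
From mathcomp Require Import reals topology normedtype convex.
From mathcomp Require Import sequences interval_inference.
From mathcomp Require Import zify ring lra.

Set Implicit Arguments.
Unset Strict Implicit.
Unset Printing Implicit Defensive.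

Import Order.TTheory GRing.Theory Num.Theory.
Import numFieldNormedType.Exports.

Local Open Scope classical_set_scope.
Local Open Scope ring_scope.

(** * Causal laws on finite paths *)

Section CausalKernels.
Variables (R : numFieldType) (T : finType) (m : nat).
Local Notation path := {ffun 'I_m -> T}.

Definition update (f : path) (j : 'I_m) (x : T) : path :=
  [ffun t => if t == j then x else f t].

Lemma updateE f j x t : update f j x t = if t == j then x else f t.
Proof. by rewrite ffunE. Qed.

Lemma update_update f j x y : update (update f j x) j y = update f j y.
Proof. by apply/ffunP => t; rewrite !ffunE; case: eqP. Qed.

Lemma update_id f j : update f j (f j) = f.
Proof. by apply/ffunP => t; rewrite ffunE; case: eqP => // ->. Qed.

(* Slots run downwards, so this says that [phi] is determined by the slots up
   to and including slot [n], in order of time. *)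
Definition determined_from (U : Type) (n : nat) (phi : path -> U) :=
  forall f g : path, (forall t : 'I_m, (n <= t)%N -> f t = g t) -> phi f = phi g.

Lemma determined_fromW (U : Type) (n n' : nat) (phi : path -> U) :
  (n <= n')%N -> determined_from n' phi -> determined_from n phi.
Proof. by move=> nn' hphi f g fg; apply: hphi => t /(leq_trans nn')/fg. Qed.

Lemma determined_from_update (U : Type) n (phi : path -> U) f (j : 'I_m) x :
  (j < n)%N -> determined_from n phi -> phi (update f j x) = phi f.
Proof.
move=> jn hphi; apply: hphi => t nt; rewrite updateE.
by case: eqP nt jn => // ->; rewrite leqNgt => /negP.
Qed.

(** A path is the same as its value in slot [j] together with the remaining slots; the latter are
    encoded by the path whose slot [j] is reset to the dummy value [x0]. *)
Lemma big_update (j : 'I_m) (x0 : T) (F : path -> R) :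
  \sum_f F f = \sum_(f : path | f j == x0) \sum_x F (update f j x).
Proof.
rewrite pair_big_dep /=.
rewrite (reindex_onto (fun q : path * T => update q.1 j q.2)
                      (fun f => (update f j x0, f j))) /=; last first.
  by move=> f _; rewrite update_update update_id.
apply: eq_bigl => -[f x] /=; rewrite andbT update_update updateE eqxx xpair_eqE.
rewrite eqxx andbT; apply/eqP/eqP => [<-|<-]; last exact: update_id.
by rewrite updateE eqxx.
Qed.

(** Since [G] does not see slot [j], a factor [H] enters only through its sum over the values of
    that slot, so one factor of a product may be exchanged for another with the same sum. *)
Lemma sum_resample (x0 : T) (j : 'I_m) (G H H' : path -> R) :
  (forall f x, G (update f j x) = G f) ->
  (forall f, \sum_x H (update f j x) = \sum_x H' (update f j x)) ->
  \sum_f G f * H f = \sum_f G f * H' f.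
Proof.
move=> hG hH; rewrite !(big_update j x0); apply: eq_bigr => f _.
under eq_bigr do rewrite hG; under [RHS]eq_bigr do rewrite hG.
by rewrite -!mulr_sumr hH.
Qed.

Variables (x0 : T) (H : 'I_m -> path -> R).
Hypothesis H_det : forall j : 'I_m, determined_from j (H j).
Hypothesis H_sum : forall j f, \sum_x H j (update f j x) = 1.

(** Each [H j] is read as the conditional law of slot [j] given the earlier slots; their product is
    then the law of a causal process and this is its expectation. *)
Definition path_mean (phi : path -> R) := \sum_f phi f * \prod_j H j f.

Let unif : R := #|T|%:R^-1.

Let unif_sum : \sum_(x : T) unif = 1.
Proof.
rewrite sumr_const -[LHS]mulr_natl; apply: mulfV.
by rewrite pnatr_eq0 -lt0n; apply/card_gt0P; exists x0.
Qed.

(** The slots that [phi] does not see integrate out one by one, the last one in time first. Their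
    kernels are replaced by the uniform law rather than deleted, so that sums keep running over
    whole paths. *)
Lemma path_mean_flatten n (phi : path -> R) : determined_from n phi ->
  path_mean phi = \sum_f phi f * \prod_(j < m) (if (j < n)%N then unif else H j f).
Proof.
move=> hphi.
suff: forall n', (n' <= n)%N -> path_mean phi =
    \sum_f phi f * \prod_(j < m) (if (j < n')%N then unif else H j f) by apply.
elim=> [_|n' IH n'n]; first by apply: eq_bigr => f _; under eq_bigr do rewrite /=.
rewrite {}IH ?(ltnW n'n)//; have [n'm|mn'] := ltnP n' m; last first.
  apply: eq_bigr => f _; congr (_ * _); apply: eq_bigr => j _.
  by rewrite ltnS (leq_trans (ltn_ord j) mn') (leq_trans (ltnW (ltn_ord j)) mn').
pose j0 := Ordinal n'm.
(* Nothing in [G] sees slot [j0]: later slots are already flat, and the kernels of earlier slots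
   look only backwards in time. *)
pose G (f : path) := phi f * \prod_(j < m | j != j0)
  (if (j < n')%N then unif else H j f).
transitivity (\sum_f G f * H j0 f).
  by apply: eq_bigr => f _; rewrite (bigD1 j0)//= ltnn /G; ring.
rewrite (@sum_resample x0 j0 _ _ (fun=> unif)).
- apply: eq_bigr => f _; rewrite [in RHS](bigD1 j0)//= ltnS leqnn /G -mulrA.
  rewrite [X in _ * X]mulrC; congr (_ * (_ * _)); apply: eq_bigr => j jj0.
  by rewrite ltnS (leq_eqVlt j n'); move: jj0; rewrite -val_eqE /= => /negbTE ->.
- move=> f x; rewrite /G (determined_from_update _ _ _ hphi)//; congr (_ * _).
  apply: eq_bigr => j jj0; case: ltnP => // n'j.
  rewrite (determined_from_update _ _ _ (@H_det j))//.
  by rewrite ltn_neqAle n'j andbT eq_sym.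
- by move=> f; rewrite H_sum unif_sum.
Qed.

(** The conditional expectation given the slots preceding [k], for [phi] that looks at no slot after
    [k]. *)
Definition path_step (k : 'I_m) (phi : path -> R) (f : path) : R :=
  \sum_x H k (update f k x) * phi (update f k x).

Lemma path_step_det (k : 'I_m) phi :
  determined_from k phi -> determined_from k.+1 (path_step k phi).
Proof.
move=> hphi f g fg; apply: eq_bigr => x _.
have e (t : 'I_m) : (k <= t)%N -> update f k x t = update g k x t.
  rewrite !updateE; case: (eqVneq t k) => // tk.
  by rewrite leq_eqVlt val_eqE eq_sym (negbTE tk) => /fg.
by rewrite (H_det e) (hphi _ _ e).
Qed.

(** Once the slots after [k] are flat, slot [k] occurs only in its own kernel and in [phi], so
    averaging [phi] over it first changes nothing. *)
Lemma path_mean_tower (k : 'I_m) phi : determined_from k phi ->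
  path_mean phi = path_mean (path_step k phi).
Proof.
move=> hphi; have hphi' := path_step_det hphi.
rewrite !(@path_mean_flatten k)//; last exact: determined_fromW hphi'.
pose G (f : path) := \prod_(j < m | j != k) (if (j < k)%N then unif else H j f).
transitivity (\sum_f G f * (H k f * phi f)).
  by apply: eq_bigr => f _; rewrite (bigD1 k)//= ltnn /G; ring.
rewrite (@sum_resample x0 k _ _ (fun f => H k f * path_step k phi f)).
- by apply: eq_bigr => f _; rewrite [in RHS](bigD1 k)//= ltnn /G; ring.
- move=> f x; apply: eq_bigr => j jk; case: ltnP => // kj.
  rewrite (determined_from_update _ _ _ (@H_det j))//.
  by rewrite ltn_neqAle kj andbT eq_sym.
- move=> f; transitivity (path_step k phi f); first by [].
  under [RHS]eq_bigr do rewrite (determined_from_update _ _ _ hphi')//.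
  by rewrite -mulr_suml H_sum mul1r.
Qed.

Lemma path_mean1 : path_mean (fun=> 1) = 1.
Proof.
rewrite (@path_mean_flatten m)//; transitivity ((\sum_(x : T) unif) ^+ m).
  rewrite -[X in _ ^+ X](card_ord m) -prodr_const.
  rewrite (bigA_distr_bigA (fun (_ : 'I_m) (_ : T) => unif)).
  by apply: eq_bigr => f _; rewrite mul1r; apply: eq_bigr => j _; rewrite ltn_ord.
by rewrite unif_sum expr1n.
Qed.

End CausalKernels.

(** * The channel *)

Section Channel.
Variables (R : realType) (p r : R).
Local Notation state := {ffun 'I_2 -> bool}.
Local Notation ps := (p_s p r).

Definition next_on (b : bool) : R := if b then p else r.

Definition transition (s s' : state) : R :=
  \prod_(i < 2) bernoulli_mass (next_on (s i)) (s' i).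

Definition stationary (s : state) : R := \prod_(i < 2) bernoulli_mass ps (s i).

Definition forecast (g : state -> R) (s : state) : R :=
  \sum_s' transition s s' * g s'.

Definition stationary_mean (g : state -> R) : R := \sum_s stationary s * g s.

Lemma sum_bernoulli_mass (q : R) : \sum_b bernoulli_mass q b = 1.
Proof. by rewrite big_bool /= addrC subrK. Qed.

Lemma sum_prod_bernoulli_mass (q : 'I_2 -> R) :
  \sum_(s : state) \prod_(i < 2) bernoulli_mass (q i) (s i) = 1.
Proof.
rewrite -(bigA_distr_bigA (fun i => bernoulli_mass (q i))).
by rewrite big1 // => i _; exact: sum_bernoulli_mass.
Qed.

Section SlotFactors.
Variable m : nat.

Definition slot_factor (k : 'I_m) (S : channel_states m) : R :=
  if insub k.+1 is Some t then transition (S t) (S k) else stationary (S k).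

(** Exchanging the products over users and slots turns two independent chains into one chain on
    pairs of states, to which the causal kernels apply. *)
Lemma channel_lawE (S : channel_states m) :
  channel_law p r S = \prod_k slot_factor k S.
Proof.
rewrite /channel_law /chain_law exchange_big /=; apply: eq_bigr => k _.
by rewrite /slot_factor; case: insub.
Qed.

Lemma slot_factor_det (k : 'I_m) : determined_from k (slot_factor k).
Proof.
move=> f g fg; rewrite /slot_factor (fg k)//.
by case: insubP => // t _ tk; rewrite (fg t)// tk.
Qed.

Lemma slot_factor_next (k t : 'I_m) S : t = k.+1 :> nat ->
  slot_factor k S = transition (S t) (S k).
Proof.
move=> tk; rewrite /slot_factor; case: insubP => [u _ uk|].
  by have -> : u = t by apply: val_inj; rewrite uk.
by rewrite -tk ltn_ord.
Qed.

Lemma slot_factor_first (k : 'I_m) S : k.+1 = m ->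
  slot_factor k S = stationary (S k).
Proof. by move=> km; rewrite /slot_factor insubF ?km ?ltnn. Qed.

Lemma slot_factor_sum (k : 'I_m) S : \sum_x slot_factor k (update S k x) = 1.
Proof.
have [km|mk] := ltnP k.+1 m.
  rewrite -[RHS](sum_prod_bernoulli_mass (fun i => next_on (S (Ordinal km) i))).
  apply: eq_bigr => x _; rewrite (@slot_factor_next k (Ordinal km))//.
  by rewrite !updateE eqxx -val_eqE /= gtn_eqF.
rewrite -[RHS](sum_prod_bernoulli_mass (fun=> ps)).
apply: eq_bigr => x _; rewrite slot_factor_first ?updateE ?eqxx//.
by apply/eqP; rewrite eqn_leq mk ltn_ord.
Qed.

Definition channel_mean := path_mean slot_factor.

Let tower := path_mean_tower [ffun=> false] slot_factor_det slot_factor_sum.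

Lemma channel_mean_markov1 (k t : 'I_m) (phi : channel_states m -> R) g :
  t = k.+1 :> nat -> determined_from t phi ->
  channel_mean (fun S => phi S * g (S k)) =
  channel_mean (fun S => phi S * forecast g (S t)).
Proof.
move=> tk hphi; rewrite /channel_mean (tower (k := k)); last first.
  move=> f f' ff'; rewrite (ff' k)// (hphi f f')// => v tv; apply: ff'.
  by apply: leq_trans tv; rewrite tk.
apply: eq_bigr => S _; congr (_ * _); rewrite /path_step mulr_sumr.
apply: eq_bigr => x _; rewrite (slot_factor_next _ tk) !updateE eqxx.
rewrite -val_eqE /= tk gtn_eqF// (determined_from_update _ _ _ hphi) ?tk//.
by ring.
Qed.

(** The Markov property over [u] slots: each use of the tower property moves the observed slot one
    step back in time, at the price of one application of the transition operator. *)
Lemma channel_mean_markov u (k t : 'I_m) (phi : channel_states m -> R) g :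
  t = (k + u)%N :> nat -> determined_from t phi ->
  channel_mean (fun S => phi S * g (S k)) =
  channel_mean (fun S => phi S * iter u forecast g (S t)).
Proof.
elim: u k g => [|u IH] k g.
  by rewrite addn0 => /val_inj ->.
move=> tku hphi; have km : (k.+1 < m)%N.
  by rewrite (leq_ltn_trans _ (ltn_ord t))// tku addnS ltnS leq_addr.
rewrite (@channel_mean_markov1 k (Ordinal km))//; last first.
  by apply: determined_fromW hphi; rewrite tku addnS /= ltnS leq_addr.
by rewrite IH ?iterSr//= tku addSnnS.
Qed.

End SlotFactors.

Hypothesis pr_lt1 : p - r < 1.

Lemma p_s_fixed : ps * p + (1 - ps) * r = ps.
Proof.
have e : ps * (1 - (p - r)) = r by rewrite /p_s divfK// subr_eq0 gt_eqF.
by move: (p_s p r) e => q e; lra.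
Qed.

Lemma stationary_transition (s' : state) :
  \sum_s stationary s * transition s s' = stationary s'.
Proof.
under eq_bigr do rewrite -big_split /=.
rewrite -(bigA_distr_bigA (fun i b =>
  bernoulli_mass ps b * bernoulli_mass (next_on b) (s' i))).
apply: eq_bigr => i _; rewrite big_bool /=.
by case: (s' i) => /=; move: (p_s p r) p_s_fixed => q; lra.
Qed.

Lemma stationary_mean_forecast g :
  stationary_mean (forecast g) = stationary_mean g.
Proof.
rewrite /stationary_mean /forecast; under eq_bigr do rewrite mulr_sumr.
rewrite exchange_big /=; apply: eq_bigr => s' _.
by rewrite -stationary_transition mulr_suml; apply: eq_bigr => s _; rewrite mulrA.
Qed.

(** The state is forecast from the first slot, where it has the stationary law by definition, and
    forecasting preserves stationary means. *)
Lemma channel_mean_stationary m (k : 'I_m) g :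
  channel_mean (fun S : channel_states m => g (S k)) = stationary_mean g.
Proof.
have m0 : (0 < m)%N by apply: leq_ltn_trans (ltn_ord k).
have lm : (m.-1 < m)%N by rewrite prednK.
have hk : (k <= m.-1)%N by rewrite -ltnS prednK.
transitivity (channel_mean (fun S : channel_states m => 1 * g (S k))).
  by apply: eq_bigr => S _; rewrite mul1r.
rewrite (@channel_mean_markov m (m.-1 - k) k (Ordinal lm))//=; last by rewrite subnKC.
set h := iter _ _ _.
have -> : stationary_mean g = stationary_mean h.
  by rewrite /h; elim: (m.-1 - k)%N => //= u IH; rewrite stationary_mean_forecast.
rewrite /channel_mean (path_mean_tower [ffun=> false] (@slot_factor_det m)
  (@slot_factor_sum m) (k := Ordinal lm)); last by move=> f f' ff'; rewrite ff'.
transitivity (stationary_mean h * path_mean (@slot_factor m) (fun=> 1)); last first.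
  by rewrite (path_mean1 [ffun=> false] (@slot_factor_det m) (@slot_factor_sum m)) mulr1.
rewrite /path_mean mulr_sumr; apply: eq_bigr => S _; rewrite mul1r; congr (_ * _).
apply: eq_bigr => x _; rewrite slot_factor_first ?prednK//.
by rewrite /= !updateE eqxx mul1r.
Qed.

Lemma Tpow_affine u x y z :
  Tpow p r u (x * y + (1 - x) * z) = x * Tpow p r u y + (1 - x) * Tpow p r u z.
Proof. by rewrite /Tpow; elim: u => //= u ->; rewrite /Tmap; ring. Qed.

(** By independence the other user sums out; the first transition produces [p] or [r], and each of
    the remaining [u] applies [Tmap]. *)
Lemma iter_forecast_on u (i : 'I_2) (s : state) :
  iter u.+1 forecast (fun s => (s i)%:R) s = Tpow p r u (next_on (s i)).
Proof.
have key (h : bool -> R) s0 : forecast (fun s => h (s i)) s0 =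
    next_on (s0 i) * h true + (1 - next_on (s0 i)) * h false.
  pose F (j : 'I_2) (b : bool) : R := 
    bernoulli_mass (next_on (s0 j)) b * (if j == i then h b else 1).
  transitivity (\sum_(s' : state) \prod_(j < 2) F j (s' j)).
    apply: eq_bigr => s' _; rewrite big_split /=; congr (_ * _).
    by rewrite (bigD1 i)//= eqxx big1 ?mulr1// => j /negbTE ->.
  rewrite -bigA_distr_bigA (bigD1 i)//= [X in _ * X]big1 ?mulr1.
    by rewrite big_bool /F /= eqxx.
  move=> j /negbTE ji; rewrite -[RHS](sum_bernoulli_mass (next_on (s0 j))).
  by apply: eq_bigr => b _; rewrite /F ji mulr1.
elim: u s => [|u IH] s.
  by rewrite /= (key (fun b => b%:R)) mulr1 mulr0 addr0.
rewrite iterS; transitivity (forecast (fun s => Tpow p r u (next_on (s i))) s).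
  by apply: eq_bigr => s' _; rewrite IH.
rewrite (key (fun b => Tpow p r u (next_on b))) /= -Tpow_affine.
exact: (esym (iterSr u (Tmap p r) _)).
Qed.

End Channel.

(** * Trajectories of a policy *)

Section Trajectories.
Variables (R : realType) (p r : R) (d : nat) (A : policy R) (m : nat).
Local Notation trajectory := (trajectory m).
Local Notation Expect := (Expect p r d A).

Definition choice_prob (k : 'I_m) (w : trajectory) : option 'I_2 -> R :=
  decide A k (arrived k w d) (past_decisions k w).

Definition decision_factor (S : channel_states m) (k : 'I_m) (a : decisions m) : R :=
  choice_prob k (S, a) (a k).

Lemma arrived_eq (k : 'I_m) (w w' : trajectory) :
  (forall t : 'I_m, (k + d < t)%N -> w.1 t = w'.1 t) ->
  (forall t : 'I_m, (k + d < t)%N -> w.2 t = w'.2 t) ->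
  arrived k w d = arrived k w' d.
Proof.
move=> e1 e2; apply/ffunP => t; rewrite !ffunE; case: ifP => // kt.
by rewrite e2// (e1 t kt).
Qed.

Lemma past_decisions_eq (k : 'I_m) (w w' : trajectory) :
  (forall t : 'I_m, (k < t)%N -> w.2 t = w'.2 t) ->
  past_decisions k w = past_decisions k w'.
Proof. by move=> e; apply/ffunP => t; rewrite !ffunE; case: ifP => // /e. Qed.

Lemma choice_prob_eq (k : 'I_m) (w w' : trajectory) :
  (forall t : 'I_m, (k + d < t)%N -> w.1 t = w'.1 t) ->
  (forall t : 'I_m, (k < t)%N -> w.2 t = w'.2 t) ->
  choice_prob k w = choice_prob k w'.
Proof.
move=> e1 e2; rewrite /choice_prob (past_decisions_eq e2) (arrived_eq e1)//.
by move=> t kt; apply: e2; apply: leq_ltn_trans kt; exact: leq_addr.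
Qed.

Lemma decision_factor_det S (k : 'I_m) : determined_from k (decision_factor S k).
Proof.
move=> f g fg; rewrite /decision_factor fg// (@choice_prob_eq _ _ (S, g))//.
by move=> t /ltnW/fg.
Qed.

Lemma choice_prob_update (k : 'I_m) S a x :
  choice_prob k (S, update a k x) = choice_prob k (S, a).
Proof.
apply: choice_prob_eq => // t kt /=; rewrite updateE.
by case: eqP kt => // ->; rewrite ltnn.
Qed.

Lemma decision_factor_sum S (k : 'I_m) a :
  \sum_x decision_factor S k (update a k x) = 1.
Proof.
rewrite -[RHS](decide_sum1 A k (arrived k (S, a) d) (past_decisions k (S, a))).
apply: eq_bigr => x _; rewrite /decision_factor choice_prob_update.
by rewrite updateE eqxx.
Qed.

Definition decision_mean S := path_mean (decision_factor S).

(** The channel evolves regardless of the decisions, so the joint law disintegrates into the channel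
    law and, for each fixed channel path, a causal law of decisions. *)
Lemma ExpectE (X : trajectory -> R) :
  Expect X = channel_mean p r (fun S => decision_mean S (fun a => X (S, a))).
Proof.
rewrite /Expect /Defs.Expect /channel_mean /decision_mean /path_mean.
under [RHS]eq_bigr do rewrite mulr_suml.
rewrite pair_bigA; apply: eq_bigr => -[S a] _ /=.
rewrite /law /= channel_lawE mulrAC mulrC mulrA [X in _ = X * _]mulrC mulrC.
by rewrite mulrC -!mulrA; congr (_ * _); exact: mulrC.
Qed.

(** The decisions up to slot [k] use feedback from slots beyond [k + d] only, so averaging over them
    brings in no more recent state. *)
Lemma decision_mean_det (k : 'I_m) (X : trajectory -> R) :
  (forall a, determined_from (k + d).+1 (fun S => X (S, a))) ->
  (forall S, determined_from k (fun a => X (S, a))) ->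
  determined_from (k + d).+1 (fun S => decision_mean S (fun a => X (S, a))).
Proof.
move=> hS ha S S' SS'; rewrite /decision_mean.
rewrite !(path_mean_flatten None (@decision_factor_det _)
  (@decision_factor_sum _) (ha _)).
apply: eq_bigr => a _; rewrite (hS a S S' SS'); congr (_ * _).
apply: eq_bigr => j _; case: ltnP => // kj.
rewrite /decision_factor (@choice_prob_eq j (S, a) (S', a))// => t jt.
by apply: SS'; apply: leq_ltn_trans jt; rewrite leq_add2r.
Qed.

(** Slot [K] is the latest one whose feedback has arrived by slot [k]. Decisions up to [k] therefore
    do not disturb the Markov property of the channel from [K] to [k]. *)
Lemma Expect_markov (k K : 'I_m) (X : trajectory -> R) g :
  K = (k + d.+1)%N :> nat ->
  (forall a, determined_from K (fun S => X (S, a))) ->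
  (forall S, determined_from k (fun a => X (S, a))) ->
  Expect (fun w => X w * g (w.1 k)) =
  Expect (fun w => X w * iter d.+1 (forecast p r) g (w.1 K)).
Proof.
move=> Kk hS ha; rewrite !ExpectE.
have hX : determined_from K (fun S => decision_mean S (fun a => X (S, a))).
  by rewrite Kk addnS in hS *; exact: decision_mean_det.
transitivity (channel_mean p r
    (fun S => decision_mean S (fun a => X (S, a)) * g (S k))).
  apply: eq_bigr => S _; congr (_ * _); rewrite /decision_mean /path_mean mulr_suml.
  by apply: eq_bigr => a _; rewrite /= mulrAC.
rewrite (channel_mean_markov _ _ _ Kk hX).
apply: eq_bigr => S _; congr (_ * _); rewrite /decision_mean /path_mean mulr_suml.
by apply: eq_bigr => a _; rewrite /= mulrAC.
Qed.

Lemma Expect_tower (k : 'I_m) (X : trajectory -> R) :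
  (forall S, determined_from k (fun a => X (S, a))) ->
  Expect X =
  Expect (fun w => \sum_x choice_prob k w x * X (w.1, update w.2 k x)).
Proof.
move=> ha; rewrite !ExpectE; apply: eq_bigr => S _; congr (_ * _).
rewrite /decision_mean (path_mean_tower None (@decision_factor_det S)
  (@decision_factor_sum S) (k := k))//.
apply: eq_bigr => a _; congr (_ * _); apply: eq_bigr => x _.
by rewrite /decision_factor choice_prob_update updateE eqxx.
Qed.

Lemma eq_Expect (X Y : trajectory -> R) : X =1 Y -> Expect X = Expect Y.
Proof. by move=> XY; apply: eq_bigr => w _; rewrite XY. Qed.

Lemma ExpectD (X Y : trajectory -> R) :
  Expect (fun w => X w + Y w) = Expect X + Expect Y.
Proof. by rewrite -big_split; apply: eq_bigr => w _; rewrite mulrDr. Qed.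

Lemma ExpectZ c (X : trajectory -> R) : Expect (fun w => c * X w) = c * Expect X.
Proof. by rewrite mulr_sumr; apply: eq_bigr => w _; rewrite mulrCA. Qed.

Lemma Expect_sum (I : finType) (P : pred I) (X : I -> trajectory -> R) :
  Expect (fun w => \sum_(i | P i) X i w) = \sum_(i | P i) Expect (X i).
Proof.
by rewrite exchange_big; apply: eq_bigr => w _; rewrite mulr_sumr.
Qed.

Lemma Expect_state (k : 'I_m) g : p - r < 1 ->
  Expect (fun w => g (w.1 k)) = stationary_mean p r g.
Proof.
move=> pr; rewrite -(channel_mean_stationary pr k) ExpectE.
apply: eq_bigr => S _; congr (_ * _).
transitivity (g (S k) * decision_mean S (fun=> 1)).
  by rewrite /decision_mean /path_mean mulr_sumr; apply: eq_bigr => a _; rewrite mul1r.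
by rewrite /decision_mean path_mean1 ?mulr1//;
  [exact: None | exact: decision_factor_det | exact: decision_factor_sum].
Qed.

Lemma ProbE (E : pred trajectory) :
  Prob p r d A E = Expect (fun w => (E w)%:R).
Proof.
by rewrite /Prob big_mkcond; apply: eq_bigr => w _; case: (E w);
  rewrite ?mulr1 ?mulr0.
Qed.

(** * Conditional independence of decision and state given the arrived feedback *)

Section Factorization.
Variables (k : 'I_m) (F : feedback_record m).

Definition states_agree (S : channel_states m) : bool :=
  [forall t, if F t is Some (i, b) then S t i == b else true].

Definition decisions_agree (a : decisions m) : bool :=
  [forall t : 'I_m, if (k + d < t)%N then a t == omap fst (F t) else F t == None].

(** Observing the record [F] is a rectangular event: [F] names the scheduled users, and its bits
    then constrain the states alone. *)
Lemma arrived_eqE S a :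
  (arrived k (S, a) d == F) = states_agree S && decisions_agree a.
Proof.
apply/eqP/andP => [e|[/forallP hS /forallP ha]].
  split; apply/forallP => t; rewrite -e ffunE /=; case: (k + d < t)%N => //;
    by case: (a t) => //= i; rewrite eqxx.
apply/ffunP => t; move: (hS t) (ha t); rewrite ffunE /=.
case: ifP => _; last by move=> _ /eqP.
by case: (F t) => [[i b] /eqP <- /eqP ->|_ /eqP ->].
Qed.

Definition states_weight (v : {ffun 'I_2 -> bool} -> R) : R :=
  channel_mean p r (fun S => (states_agree S)%:R * v (S k)).

(** The decision law with every trace of the channel removed: arrived feedback is read off from [F],
    and the all-false states are a dummy that [past_decisions] ignores. Slots after [k] are flat. *)
Definition decisions_weight (u : option 'I_2 -> R) : R :=
  \sum_(a : decisions m) (decisions_agree a)%:R * u (a k) *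
    \prod_(j < m) (if (j < k)%N then #|{: option 'I_2}|%:R^-1 else
      decide A j [ffun t : 'I_m => if (j + d < t)%N then F t else None]
        (past_decisions j ([ffun=> [ffun=> false]], a)) (a j)).

(* The arrived feedback reveals the decisions it stems from, and given it the
   later decisions use no further information on the channels. *)
Lemma Expect_factorization u v :
  Expect (fun w => (arrived k w d == F)%:R * u (w.2 k) * v (w.1 k)) =
  states_weight v * decisions_weight u.
Proof.
rewrite ExpectE /states_weight /channel_mean /path_mean mulr_suml.
apply: eq_bigr => S _; rewrite mulrAC; congr (_ * _); rewrite /decision_mean.
rewrite (path_mean_flatten (n := k) None (@decision_factor_det _)
  (@decision_factor_sum _)); last first.
  move=> f g fg /=; rewrite (fg k)// (@arrived_eq k (S, f) (S, g))// => t kt.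
  by apply: fg; apply: ltnW; apply: leq_ltn_trans kt; exact: leq_addr.
rewrite /decisions_weight mulr_sumr; apply: eq_bigr => a _ /=.
case E: (arrived k (S, a) d == F); move: (E); rewrite arrived_eqE; last first.
  by case: states_agree; case: decisions_agree => //= _; rewrite !(mul0r, mulr0).
move=> /andP[-> ->]; rewrite !mul1r -mulrA mulrCA; congr (_ * (_ * _)).
apply: eq_bigr => j _; case: ltnP => // kj.
have -> : [ffun t : 'I_m => if (j + d < t)%N then F t else None] =
    arrived j (S, a) d.
  move/eqP: E => <-; apply/ffunP => t; rewrite !ffunE /=; case: ifP => // jt.
  by rewrite ifT// (leq_ltn_trans _ jt)// leq_add2r.
by rewrite (@past_decisions_eq j _ (S, a)).
Qed.

End Factorization.

Hypothesis (p_ge0 : 0 <= p) (p_le1 : p <= 1) (r_ge0 : 0 <= r) (r_le1 : r <= 1).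
Hypothesis pr_lt1 : p - r < 1.

Lemma p_s_ge0 : 0 <= p_s p r.
Proof. by rewrite /p_s divr_ge0// subr_ge0 ltW. Qed.

Lemma p_s_le1 : p_s p r <= 1.
Proof. by rewrite /p_s ler_pdivrMr ?subr_gt0// mul1r opprB addrCA lerDl subr_ge0. Qed.

Lemma bernoulli_mass_ge0 (q : R) b : 0 <= q <= 1 -> 0 <= bernoulli_mass q b.
Proof. by case: b => /= /andP[]//; rewrite subr_ge0. Qed.

Lemma stationary_ge0 s : 0 <= stationary p r s.
Proof.
by apply: prodr_ge0 => i _; rewrite bernoulli_mass_ge0// p_s_ge0 p_s_le1.
Qed.

Lemma law_ge0 (w : trajectory) : 0 <= law p r d A w.
Proof.
rewrite /law mulr_ge0//; last by apply: prodr_ge0 => k _; exact: decide_ge0.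
rewrite channel_lawE; apply: prodr_ge0 => k _; rewrite /slot_factor.
case: insub => [t|]; last exact: stationary_ge0.
apply: prodr_ge0 => i _; apply: bernoulli_mass_ge0.
by rewrite /next_on; case: (w.1 t i); apply/andP.
Qed.

Lemma le_Expect (X Y : trajectory -> R) :
  (forall w, X w <= Y w) -> Expect X <= Expect Y.
Proof.
by move=> XY; apply: ler_sum => w _; rewrite ler_wpM2l// law_ge0.
Qed.

Lemma Expect_ge0 (X : trajectory -> R) : (forall w, 0 <= X w) -> 0 <= Expect X.
Proof. by move=> X0; apply: sumr_ge0 => w _; rewrite mulr_ge0// law_ge0. Qed.

Definition success_prob (k : 'I_m) (i : 'I_2) : R :=
  Expect (fun w => (w.2 k == Some i)%:R * (w.1 k i)%:R).

(** Split according to the arrived record [F]. Given [F], decision and state are independent, so the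
    state indicator may be replaced by its conditional probability. *)
Lemma Expect_belief (k : 'I_m) (i : 'I_2) :
  Expect (fun w => (w.2 k == Some i)%:R * belief p r d A k i w) = success_prob k i.
Proof.
have split_arrived (X : trajectory -> R) :
    Expect X = \sum_F Expect (fun w => (arrived k w d == F)%:R * X w).
  rewrite -Expect_sum; apply: eq_Expect => w.
  rewrite (bigD1 (arrived k w d))//= eqxx mul1r big1 ?addr0// => F.
  by rewrite eq_sym => /negbTE ->; rewrite mul0r.
rewrite /success_prob !split_arrived; apply: eq_bigr => F _.
pose one := fun _ : option 'I_2 => 1 : R.
pose u (x : option 'I_2) : R := (x == Some i)%:R.
pose v (s : {ffun 'I_2 -> bool}) : R := (s i)%:R.
pose one' := fun _ : {ffun 'I_2 -> bool} => 1 : R.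
pose a0 := states_weight k F one'; pose a1 := states_weight k F v.
pose b0 := decisions_weight k F one; pose b1 := decisions_weight k F u.
have joint : Expect (fun w : trajectory => (arrived k w d == F)%:R *
    ((w.2 k == Some i)%:R * (w.1 k i)%:R)) = a1 * b1.
  by rewrite -Expect_factorization; apply: eq_Expect => w; rewrite mulrA.
have num : Prob p r d A [pred w : trajectory | w.1 k i & arrived k w d == F] = a1 * b0.
  rewrite ProbE -Expect_factorization; apply: eq_Expect => w /=.
  by rewrite mulr1 andbC /v; case: (w.1 k i); case: (arrived k w d == F); rewrite ?(mulr1, mulr0).
have den : Prob p r d A [pred w : trajectory | arrived k w d == F] = a0 * b0.
  by rewrite ProbE -Expect_factorization; apply: eq_Expect => w /=; rewrite !mulr1.
transitivity (a1 * b0 / (a0 * b0) * (a0 * b1)).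
  rewrite -[a0 * b1]Expect_factorization -ExpectZ; apply: eq_Expect => w.
  case: eqP => [e|_]; last by rewrite !(mul0r, mulr0).
  by rewrite /belief e num den !mul1r mulr1 mulrC.
rewrite joint; have [ab0|ab0] := eqVneq (a0 * b0) 0; last first.
  by move: ab0; rewrite mulf_eq0 => /norP[a00 b00]; field; rewrite a00 b00.
(* A record of probability zero has belief [0] because division by zero gives [0]; the right-hand
   side vanishes too, being at most the probability of the record. *)
rewrite ab0 invr0 mulr0 mul0r; apply/esym/eqP; rewrite eq_le; apply/andP; split.
  rewrite -ab0 -den ProbE -joint; apply: le_Expect => w /=.
  by rewrite -!natrM ler_nat; case: (w.1 k i); case: (w.2 k == Some i); case: eqP.
by rewrite -joint; apply: Expect_ge0 => w; rewrite !mulr_ge0.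
Qed.

End Trajectories.

(** * The genie bound *)

Lemma cvg_divn (R : realType) (C : R) : (C / m%:R) @[m --> \oo] --> (0 : R).
Proof.
rewrite -(cvg_shiftS (fun m => C / m%:R)).
have := cvgM (cvg_cst C) (@cvg_harmonic R); rewrite mulr0. exact.
Qed.

Lemma cvg_le_divn (R : realType) (u : nat -> R) (l C M : R) :
  u m @[m --> \oo] --> l -> (forall m, u m <= C + M / m%:R) -> l <= C.
Proof.
move=> ul uC; have h : (C + M / m%:R) @[m --> \oo] --> (C + 0 : R).
  exact: (cvgD (cvg_cst C) (cvg_divn M)).
by rewrite -[C]addr0; apply: ler_cvg_to ul h _; apply: nearW.
Qed.

Lemma cvg_dist_divn (R : realType) (u : nat -> R) (l M : R) :
  (forall m, (0 < m)%N -> `|u m - l| <= M / m%:R) -> u m @[m --> \oo] --> l.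
Proof.
move=> uM; have hM := cvg_divn M.
apply: (@squeeze_cvgr _ _ _ _ (fun m => l - M / m%:R) (fun m => l + M / m%:R)).
- by exists 1%N => // m /= /uM; rewrite ler_distl.
- by rewrite -[X in _ --> X]subr0; exact: (cvgB (cvg_cst l) hM).
- by rewrite -[X in _ --> X]addr0; exact: (cvgD (cvg_cst l) hM).
Qed.

(** For [e = d.+1] these are the slots at the start of the horizon where no feedback can have
    arrived; being boundedly many, they vanish in the time average. *)
Lemma card_last_slots (m e : nat) : (\sum_(k < m) (m <= k + e) <= e)%N.
Proof.
elim: m => [|m IH]; first by rewrite big_ord0.
have [me|em] := ltnP m e.
  apply: (@leq_trans (\sum_(k < m.+1) 1)); last by rewrite sum1_card card_ord.
  by apply: leq_sum => k _; case: leqP.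
rewrite big_ord_recl /= add0n ltnNge em add0n.
by rewrite (leq_trans _ IH)//; apply: leq_sum => k _.
Qed.

Lemma ord2_neq0 (i : 'I_2) : i != 0 -> i = 1.
Proof. by case: i => -[|[|//]] // lti _; apply: val_inj. Qed.

Lemma big_ord2 (V : nmodType) (F : 'I_2 -> V) : \sum_i F i = F 0 + F 1.
Proof. by rewrite big_ord_recl big_ord1; congr (_ + F _); apply: val_inj. Qed.

Section Rates.
Variables (R : realType) (p r : R) (d : nat).
Hypothesis (p_ge0 : 0 <= p) (p_le1 : p <= 1) (r_ge0 : 0 <= r) (r_le1 : r <= 1).
Hypothesis pr_lt1 : p - r < 1.
Local Notation state := {ffun 'I_2 -> bool}.
Local Notation ps := (p_s p r).

Lemma stationary_meanE (h : bool -> bool -> R) :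
  stationary_mean p r (fun s => h (s 0) (s 1)) =
  \sum_b \sum_b' bernoulli_mass ps b * bernoulli_mass ps b' * h b b'.
Proof.
rewrite pair_bigA /=.
rewrite (reindex (fun s : state => (s 0, s 1))); last first.
  exists (fun b => [ffun i => if i == 0 then b.1 else b.2]) => [s _|[b b'] _].
    apply/ffunP => i; rewrite ffunE; case: (eqVneq i 0) => [->//|i0] /=.
    by rewrite (ord2_neq0 i0).
  by rewrite !ffunE.
apply: eq_bigr => s _; congr (_ * _).
by rewrite /stationary big_ord_recl big_ord1; congr (_ * bernoulli_mass _ (s _)); apply: val_inj.
Qed.

Lemma Tpow_stationary u : ps * Tpow p r u p + (1 - ps) * Tpow p r u r = ps.
Proof.
rewrite -Tpow_affine p_s_fixed // /Tpow; elim: u => //= u ->.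
exact: p_s_fixed.
Qed.

Lemma Tpow_gap u : Tpow p r u p - Tpow p r u r = (p - r) ^+ u.+1.
Proof.
elim: u => [|u IH]; first by rewrite expr1.
by rewrite exprS -IH /Tpow /= /Tmap; ring.
Qed.

Lemma Tpow_ge u : r <= p -> r <= Tpow p r u r.
Proof.
move=> rp; elim: u => [//|u IH].
rewrite -[Tpow _ _ _ _]/(Tmap p r (Tpow p r u r)) /Tmap.
have : 0 <= Tpow p r u r * (p - r).
  by rewrite mulr_ge0 ?subr_ge0// (le_trans r_ge0).
by lra.
Qed.

Section Policy.
Variable A : policy R.
Local Notation success_prob := (success_prob p r d A).

Lemma user_rateE i m :
  user_rate p r d A i m = (\sum_(k < m) success_prob k i) / m%:R.
Proof.
rewrite /user_rate; congr (_ / _); under eq_bigr do rewrite -Expect_belief//.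
rewrite -Expect_sum; apply: eq_Expect => w; rewrite big_mkcond /=.
by apply: eq_bigr => k _; case: eqP; rewrite ?mul1r ?mul0r.
Qed.

Lemma sum_rateE m :
  sum_rate p r d A m = user_rate p r d A 0 m + user_rate p r d A 1 m.
Proof.
rewrite /user_rate -mulrDl -ExpectD /sum_rate; congr (_ / _).
apply: eq_Expect => w; rewrite !(big_mkcond (fun k => w.2 k == _)) -big_split.
apply: eq_bigr => k _ /=; case: (w.2 k) => [i|]; last by rewrite addr0.
case: (eqVneq i 0) => [->|i0]; first by rewrite /= addr0.
by rewrite (ord2_neq0 i0) /= add0r.
Qed.

Lemma success_prob_ge0 m (k : 'I_m) i : 0 <= success_prob k i.
Proof. by apply: Expect_ge0 => // w; rewrite mulr_ge0. Qed.

Lemma Expect_cst m (k : 'I_m) c : Expect p r d A (fun _ : trajectory m => c) = c.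
Proof.
rewrite (Expect_state d A k (fun=> c))// /stationary_mean -mulr_suml.
by rewrite sum_prod_bernoulli_mass mul1r.
Qed.

Lemma success_prob_le1 m (k : 'I_m) i : success_prob k i <= 1.
Proof.
rewrite -[leRHS](Expect_cst k); apply: le_Expect => // w.
by rewrite -natrM (ler_nat _ _ 1); case: eqP; case: (w.1 k i).
Qed.

(* A genie revealing both states in slot [k + d + 1] can only help, and then
   the best choice in slot [k] is a pointwise maximum. *)
Lemma success_prob_genie m (k K : 'I_m) (c : 'I_2 -> R) (G : state -> R) :
  K = (k + d.+1)%N :> nat -> (forall s : state, 0 <= G s) ->
  (forall (s : state) i, c i * Tpow p r d (next_on p r (s i)) <= G s) ->
  \sum_i c i * success_prob k i <= stationary_mean p r G.
Proof.
move=> Kk G0 cG; rewrite -(Expect_state d A K)//.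
under eq_bigr => i _.
  rewrite /success_prob (@Expect_markov _ _ _ _ _ _ _ K _ (fun s => (s i)%:R))//; last first.
    by move=> S f g fg /=; rewrite (fg k).
  rewrite -ExpectZ.
  over.
rewrite -Expect_sum; apply: le_Expect => // w.
under eq_bigr do rewrite iter_forecast_on.
case: (w.2 k) => [i|]; last by rewrite big1// => i _; rewrite mul0r mulr0.
rewrite (bigD1 i)//= eqxx mul1r big1 ?addr0// => j ji.
by rewrite (inj_eq Some_inj) eq_sym (negbTE ji) mul0r mulr0.
Qed.

(** The slotwise genie bound is summed over the horizon. The first [d.+1] slots in time have no slot
    for the genie to reveal and are bounded by the trivial [\sum_i c i]. *)
Lemma genie_bound m (c : 'I_2 -> R) (G : state -> R) :
  (forall i, 0 <= c i) -> (forall s : state, 0 <= G s) ->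
  (forall (s : state) i, c i * Tpow p r d (next_on p r (s i)) <= G s) ->
  c 0 * user_rate p r d A 0 m + c 1 * user_rate p r d A 1 m <=
  stationary_mean p r G + (d.+1%:R * \sum_i c i) / m%:R.
Proof.
move=> c0 G0 cG; set C := stationary_mean p r G; set B := \sum_i c i.
have C0 : 0 <= C.
  by apply: sumr_ge0 => s _; rewrite mulr_ge0// stationary_ge0.
have B0 : 0 <= B by apply: sumr_ge0.
rewrite !user_rateE !mulrA -mulrDl.
case: (posnP m) => [->|m0]; first by rewrite invr0 !mulr0 addr0.
rewrite ler_pdivrMr ?ltr0n// mulrDl divfK ?pnatr_eq0 -?lt0n//.
have -> : c 0 * (\sum_(k < m) success_prob k 0) + c 1 * (\sum_(k < m) success_prob k 1)
    = \sum_(k < m) \sum_i c i * success_prob k i.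
  rewrite !mulr_sumr -big_split; apply: eq_bigr => k _.
  by rewrite big_ord2.
apply: (@le_trans _ _ (\sum_(k < m) (C + (m <= k + d.+1)%N%:R * B))).
  apply: ler_sum => k _; case: leqP => [mk|km].
    rewrite mul1r (@le_trans _ _ B)// ?lerDr//; apply: ler_sum => i _.
    by rewrite ler_piMr// success_prob_le1.
  by rewrite mul0r addr0; exact: (success_prob_genie (K := Ordinal km)).
rewrite big_split /= sumr_const card_ord mulr_natr lerD2l -mulr_suml.
by rewrite ler_wpM2r// -natr_sum ler_nat card_last_slots.
Qed.

End Policy.
End Rates.

(** * The greedy policy *)

Lemma big_option (V : nmodType) (T : finType) (F : option T -> V) :
  \sum_x F x = F None + \sum_i F (Some i).
Proof.
rewrite (bigD1 None)//=; congr (_ + _).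
by rewrite (reindex_omap Some id) /=; [apply: eq_bigl => i; rewrite eqxx | case].
Qed.

Lemma rev_ord2_0 : rev_ord (0 : 'I_2) = 1. Proof. exact: val_inj. Qed.

Lemma rev_ord2_1 : rev_ord (1 : 'I_2) = 0. Proof. exact: val_inj. Qed.

(** * Invariance of the channel under exchange of the two users *)

Section Symmetry.
Variables (R : realType) (p r : R).
Local Notation state := {ffun 'I_2 -> bool}.

Definition flip (s : state) : state := [ffun i => s (rev_ord i)].

Lemma flipK : involutive flip.
Proof. by move=> s; apply/ffunP => i; rewrite !ffunE rev_ordK. Qed.

Lemma transition_flip s s' : transition p r (flip s) (flip s') = transition p r s s'.
Proof.
rewrite /transition (reindex_inj rev_ord_inj) /=.
by apply: eq_bigr => i _; rewrite !ffunE rev_ordK.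
Qed.

Lemma stationary_flip s : stationary p r (flip s) = stationary p r s.
Proof.
rewrite /stationary (reindex_inj rev_ord_inj) /=.
by apply: eq_bigr => i _; rewrite !ffunE rev_ordK.
Qed.

Lemma stationary_mean_flip g :
  stationary_mean p r (g \o flip) = stationary_mean p r g.
Proof.
rewrite /stationary_mean [RHS](reindex_inj (inv_inj flipK)) /=.
by apply: eq_bigr => s _; rewrite stationary_flip.
Qed.

Lemma iter_forecast_flip u g s :
  iter u (forecast p r) (g \o flip) s = iter u (forecast p r) g (flip s).
Proof.
elim: u s => //= u IH s; rewrite [in RHS]/forecast.
rewrite (reindex_inj (inv_inj flipK)) /=.
by apply: eq_bigr => s' _; rewrite transition_flip IH.
Qed.

End Symmetry.

(** * The policy, its interleaved chains and their limiting rates *)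

Section GreedyPolicy.
Variables (R : realType) (d : nat) (n : nat -> nat) (c : 'I_2 -> R).
Hypothesis c_ge0 : forall i, 0 <= c i.
Hypothesis c_le1 : \sum_i c i <= 1.
Local Notation state := {ffun 'I_2 -> bool}.

Definition fair (x : option 'I_2) : R := if x is Some _ then 1 / 2 else 0.

Definition mixed (x : option 'I_2) : R :=
  if x is Some i then c i else 1 - \sum_i c i.

Definition follow (i : 'I_2) (on : bool) : 'I_2 := if on then i else rev_ord i.

Definition follow_choice (f : option ('I_2 * bool)) (x : option 'I_2) : R :=
  if f is Some (i, b) then (x == Some (follow i b))%:R else fair x.

(* Feedback from outside the last [n m] slots is ignored, so that each of the
   [d.+1] interleaved greedy chains starts from a fair coin. *)
Definition greedy_rule m (k : 'I_m) (F : feedback_record m) (a : decisions m) :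
    option 'I_2 -> R :=
  if (n m <= k)%N then mixed
  else follow_choice
    (if (k + d.+1 < n m)%N then obind F (insub (k + d.+1)%N) else None).

Lemma fair_ge0 x : 0 <= fair x.
Proof. by case: x => //= _; rewrite divr_ge0. Qed.

Lemma fair_sum1 : \sum_x fair x = 1.
Proof. by rewrite big_option big_ord2 /= add0r -splitr. Qed.

Lemma follow_choice_ge0 f x : 0 <= follow_choice f x.
Proof. by case: f => [[i b]|] /=; rewrite ?fair_ge0. Qed.

Lemma follow_choice_sum f (g : option 'I_2 -> R) :
  \sum_x follow_choice f x * g x =
  if f is Some (i, b) then g (Some (follow i b)) else \sum_x fair x * g x.
Proof.
case: f => [[i b]|//] /=; rewrite (bigD1 (Some (follow i b)))//= eqxx mul1r.
by rewrite big1 ?addr0// => x /negbTE ->; rewrite mul0r.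
Qed.

Lemma greedy_rule_ge0 m (k : 'I_m) F a x : 0 <= greedy_rule k F a x.
Proof.
rewrite /greedy_rule; case: ifP => _; last exact: follow_choice_ge0.
by case: x => [i|] /=; rewrite ?subr_ge0.
Qed.

Lemma greedy_rule_sum1 m (k : 'I_m) F a : \sum_x greedy_rule k F a x = 1.
Proof.
rewrite /greedy_rule; case: ifP => _.
  by rewrite big_option /= subrK.
set f := (X in follow_choice X); under eq_bigr do rewrite -[follow_choice _ _]mulr1.
rewrite follow_choice_sum; case: f => [[]//|].
by under eq_bigr do rewrite mulr1; exact: fair_sum1.
Qed.

Definition greedy_policy : policy R := Policy greedy_rule_ge0 greedy_rule_sum1.

Variables (p r : R).
Hypothesis (p_ge0 : 0 <= p) (p_le1 : p <= 1) (r_ge0 : 0 <= r) (r_le1 : r <= 1).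
Hypothesis pr_lt1 : p - r < 1.
Hypothesis n_le : forall m, (n m <= m)%N.
Local Notation Expect := (Expect p r d greedy_policy).
Local Notation success_prob := (success_prob p r d greedy_policy).
Local Notation prob_of := (choice_prob d greedy_policy).
Local Notation ps := (p_s p r).
Local Notation Tdp := (Tpow p r d p).
Local Notation Tdr := (Tpow p r d r).

Section Horizon.
Variable m : nat.

Definition slot_mean (k : 'I_m) (h : option 'I_2 -> state -> R) : R :=
  Expect (fun w => h (w.2 k) (w.1 k)).

Lemma slot_mean_tower (k : 'I_m) h :
  slot_mean k h = Expect (fun w => \sum_x prob_of k w x * h x (w.1 k)).
Proof.
rewrite /slot_mean (@Expect_tower _ _ _ _ _ _ k); last by move=> S f g fg /=; rewrite fg.
by apply: eq_Expect => w; apply: eq_bigr => x _; rewrite /= updateE eqxx.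
Qed.

Lemma choice_prob_mixed (k : 'I_m) w : (n m <= k)%N -> prob_of k w = mixed.
Proof. by move=> nk; rewrite /choice_prob /= /greedy_rule nk. Qed.

Lemma choice_prob_fair (k : 'I_m) w : (k < n m)%N -> (n m <= k + d.+1)%N ->
  prob_of k w = fair.
Proof.
by move=> kn nk; rewrite /choice_prob /= /greedy_rule leqNgt kn /= ltnNge nk.
Qed.

Lemma choice_prob_follow (k K : 'I_m) (w : trajectory m) :
  K = (k + d.+1)%N :> nat -> (K < n m)%N ->
  prob_of k w = follow_choice (omap (fun i => (i, w.1 K i)) (w.2 K)).
Proof.
move=> Kk Kn; have kn : (k < n m)%N by apply: leq_ltn_trans Kn; rewrite Kk leq_addr.
rewrite /choice_prob /= /greedy_rule leqNgt kn /= -Kk Kn valK /= ffunE.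
by rewrite Kk addnS ltnS leqnn.
Qed.

Lemma choice_prob_busy (k : 'I_m) w : (k < n m)%N -> prob_of k w None = 0.
Proof.
move=> kn; rewrite /choice_prob /= /greedy_rule leqNgt kn /=.
by case: ifP => // _; case: insubP => //= K _ _; case: (_ K) => [[]|].
Qed.

(** Under the greedy rule, decision and state sampled every [d.+1] slots form a Markov chain; this
    is its transition operator on functions. *)
Definition pullback (h : option 'I_2 -> state -> R) (y : option 'I_2) (s : state) : R :=
  let g x := iter d.+1 (forecast p r) (h x) s in
  if y is Some i then g (Some (follow i (s i))) else \sum_x fair x * g x.

Lemma slot_mean_follow (k K : 'I_m) h :
  K = (k + d.+1)%N :> nat -> (K < n m)%N ->
  slot_mean k h = slot_mean K (pullback h).
Proof.
move=> Kk Kn; rewrite slot_mean_tower Expect_sum.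
have -> : slot_mean K (pullback h) = Expect (fun w => \sum_x
    prob_of k w x * iter d.+1 (forecast p r) (h x) (w.1 K)).
  apply: eq_Expect => w; rewrite (choice_prob_follow _ Kk)// follow_choice_sum.
  by rewrite /pullback; case: (w.2 K).
rewrite Expect_sum; apply: eq_bigr => x _.
apply: (@Expect_markov _ _ _ _ _ _ _ _ (fun w => prob_of k w x) (h x) Kk).
  move=> a S S' SS'; congr (_ x); apply: choice_prob_eq => //= t kt.
  by apply: SS'; rewrite Kk addnS.
move=> S a a' aa'; congr (_ x); apply: choice_prob_eq => //= t kt.
by apply: aa'; exact: ltnW.
Qed.

Lemma pullback_flip h y s :
  pullback (fun x t => h (omap (@rev_ord 2) x) (flip t)) y s =
  pullback h (omap (@rev_ord 2) y) (flip s).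
Proof.
rewrite /pullback; case: y => [i|] /=.
  rewrite -[LHS]/(iter d.+1 (forecast p r) (h (Some (rev_ord (follow i (s i)))) \o flip) s).
  rewrite iter_forecast_flip ffunE rev_ordK; congr (forecast _ _ (iter _ _ (h (Some _))) _).
  by rewrite /follow; case: (s i).
rewrite !big_option /= !mul0r !add0r (reindex_inj rev_ord_inj) /=.
apply: eq_bigr => i _; rewrite rev_ordK; congr (_ * _).
exact: (iter_forecast_flip p r d.+1 (h (Some i))).
Qed.

(** Induction back in time along one chain: its start is symmetric, a fair coin independent of a
    stationary state, and the transition operator commutes with the exchange of users. *)
Lemma slot_mean_flip (k : 'I_m) h : (k < n m)%N ->
  slot_mean k (fun x t => h (omap (@rev_ord 2) x) (flip t)) = slot_mean k h.
Proof.
have [e] := ubnP (m - k); elim: e k h => // e IH k h mke kn.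
have [nk|kn'] := leqP (n m) (k + d.+1).
  rewrite !slot_mean_tower.
  have aux h' : Expect (fun w : trajectory m => \sum_x prob_of k w x * h' x (w.1 k))
      = \sum_i 1 / 2 * stationary_mean p r (h' (Some i)).
    under eq_bigr do rewrite -(Expect_state d greedy_policy k)// -ExpectZ.
    rewrite -Expect_sum; apply: eq_Expect => w.
    by rewrite choice_prob_fair// big_option /= mul0r add0r.
  rewrite (aux h) (aux (fun x t => h (omap (@rev_ord 2) x) (flip t))).
  rewrite [RHS](reindex_inj rev_ord_inj) /=; apply: eq_bigr => i _.
  by rewrite -(stationary_mean_flip p r (h (Some (rev_ord i)))).
have Km : (k + d.+1 < m)%N by apply: leq_trans kn' (n_le m).
rewrite [LHS](@slot_mean_follow k (Ordinal Km))//.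
rewrite [RHS](@slot_mean_follow k (Ordinal Km))// -[RHS]IH//=; last by lia.
by apply: eq_Expect => w; exact: pullback_flip.
Qed.

(** The best success probability of the genie under equal weights: one ON channel is enough for
    [Tdp]. *)
Definition genie_sum (s : state) : R := if s 0 || s 1 then Tdp else Tdr.

(** By symmetry both users succeed equally often, and the sum of their probabilities is the genie
    value because following is an optimal choice. *)
Lemma success_prob_follow (k : 'I_m) i : (k + d.+1 < n m)%N ->
  success_prob k i = stationary_mean p r genie_sum / 2.
Proof.
move=> kn; have Km : (k + d.+1 < m)%N by apply: leq_trans kn (n_le m).
pose K := Ordinal Km; have k_n : (k < n m)%N by apply: leq_ltn_trans kn; exact: leq_addr.
have sp01 : success_prob k 1 = success_prob k 0.
  rewrite -[RHS](@slot_mean_flip k (fun x s => (x == Some 0)%:R * (s 0)%:R))//.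
  apply: eq_Expect => w; rewrite ffunE rev_ord2_0; congr (_%:R * _).
  case: (w.2 k) => //= j; rewrite !(inj_eq Some_inj) -(inj_eq rev_ord_inj).
  by rewrite rev_ord2_1.
have sp_sum : success_prob k 0 + success_prob k 1 = stationary_mean p r genie_sum.
  pose h (x : option 'I_2) (s : state) : R := if x is Some i then (s i)%:R else 0.
  transitivity (slot_mean k h).
    rewrite -ExpectD; apply: eq_Expect => w; rewrite /h; case: (w.2 k) => [j|].
      rewrite !(inj_eq Some_inj); case: (eqVneq j 0) => [->|/ord2_neq0 ->] /=.
        by rewrite mul1r mul0r addr0.
      by rewrite mul1r mul0r add0r.
    by rewrite !mul0r addr0.
  rewrite (@slot_mean_follow k K)// slot_mean_tower -(Expect_state d greedy_policy K)//.
  apply: eq_Expect => w.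
  transitivity (\sum_x prob_of K w x * genie_sum (w.1 K)); last first.
    by rewrite -mulr_suml decide_sum1 mul1r.
  apply: eq_bigr => -[j|] _; last by rewrite choice_prob_busy ?mul0r.
  (* If user [j] was ON, staying yields [Tdp]; if it was OFF, switching yields the maximum whatever
     the state of the other user. *)
  congr (_ * _); rewrite /pullback /h (iter_forecast_on p r d) /genie_sum /follow.
  case: (eqVneq j 0) => [->|/ord2_neq0 ->]; rewrite ?rev_ord2_0 ?rev_ord2_1.
    by case: ifP => [->|_]; case: (w.1 K 1).
  by case: ifP => [->|_]; case: (w.1 K 0).
have -> : success_prob k i = success_prob k 0.
  by case: (eqVneq i 0) => [->//|/ord2_neq0 ->].
by rewrite -sp_sum sp01 mulrDl -splitr.
Qed.

Lemma success_prob_mixed (k : 'I_m) i : (n m <= k)%N -> success_prob k i = c i * ps.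
Proof.
move=> nk.
have -> : ps = stationary_mean p r (fun s => (s i)%:R).
  case: (eqVneq i 0) => [->|/ord2_neq0 ->].
    rewrite (stationary_meanE p r (fun b _ => b%:R)) !big_bool /=; ring.
  rewrite (stationary_meanE p r (fun _ b => b%:R)) !big_bool /=; ring.
rewrite -(Expect_state d greedy_policy k)// -ExpectZ.
rewrite -[LHS]/(slot_mean k (fun x s => (x == Some i)%:R * (s i)%:R)).
rewrite slot_mean_tower; apply: eq_Expect => w; rewrite choice_prob_mixed//.
rewrite (bigD1 (Some i))//= eqxx mul1r big1 ?addr0// => x /negbTE ->.
by rewrite mul0r mulr0.
Qed.

End Horizon.

(** The success probabilities are compared with the two-valued profile [tau]. They differ only where
    a greedy chain starts, and rounding [gamma * m] to [n m] costs one slot at most; both errors are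
    bounded in [m]. *)
Lemma greedy_throughput (gamma : R) i :
  (forall m, `|(n m)%:R - gamma * m%:R| <= 1) ->
  is_throughput p r d greedy_policy i
    (gamma * (stationary_mean p r genie_sum / 2) + (1 - gamma) * (c i * ps)).
Proof.
move=> n_gamma; set C2 := _ / 2; set q := c i * ps.
apply: (@cvg_dist_divn _ _ _ (d.+1%:R * (1 + `|C2|) + `|C2 - q|)) => m m0.
rewrite user_rateE// -[X in _ - X](mulfK (x := m%:R)) ?pnatr_eq0 -?lt0n//.
rewrite -mulrBl normrM normfV [`|m%:R|]ger0_norm// ler_pM2r ?invr_gt0 ?ltr0n//.
pose tau (k : 'I_m) : R := if (k < n m)%N then C2 else q.
have tau_sum : \sum_(k < m) tau k = (n m)%:R * C2 + (m%:R - (n m)%:R) * q.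
  rewrite -(@big_mkord _ 0 _ m xpredT (fun k => if (k < n m)%N then C2 else q)).
  rewrite (@big_cat_nat _ _ _ (n m))//=; congr (_ + _).
    rewrite (@eq_big_nat _ _ _ _ _ _ (fun=> C2)); first by rewrite sumr_const_nat subn0 mulr_natl.
    by move=> k /= ->.
  rewrite (@eq_big_nat _ _ _ _ _ _ (fun=> q)); first by rewrite sumr_const_nat -natrB// mulr_natl.
  by move=> k /andP[nk _]; rewrite ltnNge nk.
have -> : \sum_(k < m) success_prob k i - (gamma * C2 + (1 - gamma) * q) * m%:R =
  (\sum_(k < m) success_prob k i - \sum_(k < m) tau k) +
  ((n m)%:R - gamma * m%:R) * (C2 - q).
  by rewrite tau_sum; move: (\sum_k _) (n m)%:R m%:R => S N M; ring.
apply: le_trans (ler_normD _ _) _; apply: lerD; last first.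
  by rewrite normrM -[leRHS]mul1r ler_wpM2r.
rewrite -sumrB; apply: le_trans (ler_norm_sum _ _ _) _.
pose late k := ((k < n m) && (n m <= k + d.+1))%N.
apply: (@le_trans _ _ (\sum_(k < m) (late k)%:R * (1 + `|C2|))).
  apply: ler_sum => k _; rewrite /tau /late.
  have [nk|kn] /= := leqP (n m) k; first by rewrite success_prob_mixed// subrr normr0 mul0r.
  have [nk|kn'] /= := leqP (n m) (k + d.+1); last first.
    by rewrite success_prob_follow// subrr normr0 mul0r.
  rewrite mul1r (le_trans (ler_normB _ _))// lerD2r ger0_norm.
    exact: success_prob_le1.
  exact: success_prob_ge0.
rewrite -mulr_suml ler_wpM2r ?addr_ge0// -natr_sum ler_nat.
apply: leq_trans (card_last_slots (n m) d.+1).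
rewrite (big_ord_widen m (fun k => (n m <= k + d.+1)%N : nat))// [leqRHS]big_mkcond /=.
by apply: leq_sum => k _; rewrite /late; case: ifP.
Qed.

End GreedyPolicy.

(** * The capacity region *)

Section Hull.
Variable R : realType.

Lemma convex_set_mix (S : set (R * R)) (u v : R * R) (t : R) :
  @convex_set R (R * R)%type S -> 0 <= t -> t <= 1 -> S u -> S v ->
  S (t *: u + (1 - t) *: v).
Proof.
move=> convS t0 t1 Su Sv; have /(_ (Itv01 t0 t1)) := @convS u v.
by move=> /(_ (mem_set Su) (mem_set Sv)) /set_mem.
Qed.

(** Take the convex combination of [u] and [v] with weights proportional to [s] and [t], then shrink
    it towards the origin by [s + t]. *)
Lemma convex_set_cone (S : set (R * R)) (u v : R * R) (s t : R) :
  @convex_set R (R * R)%type S -> S 0 -> S u -> S v ->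
  0 <= s -> 0 <= t -> s + t <= 1 -> S (s *: u + t *: v).
Proof.
move=> convS S0 Su Sv s0 t0 st1; have [st0|stN0] := eqVneq (s + t) 0.
  have [-> ->] : s = 0 /\ t = 0 by split; lra.
  by rewrite !scale0r addr0.
have stp : 0 < s + t by rewrite lt_neqAle eq_sym stN0 addr_ge0.
have Sw : S ((s / (s + t)) *: u + (1 - s / (s + t)) *: v).
  apply: convex_set_mix => //; first by rewrite divr_ge0// ltW.
  by rewrite ler_pdivrMr// mul1r lerDl.
have := convex_set_mix convS (ltW stp) st1 Sw S0.
rewrite scaler0 addr0 scalerDr !scalerA; congr (S (_ *: _ + _ *: _)); field.
  by [].
by [].
Qed.

(* The pentagon is cut into three triangles by the rays from the origin through
   its other vertices. *)
Lemma pentagon_hull (ps a b x y : R) :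
  0 < ps -> 0 <= b -> b < a -> 0 <= x -> 0 <= y ->
  x + y <= a + b -> b * x + (ps - a) * y <= ps * b ->
  (ps - a) * x + b * y <= ps * b ->
  hull [:: (0, 0); (ps, 0); (a, b); (b, a); (0, ps)] (x, y).
Proof.
move=> ps0 b0 ba x0 y0 sum_le h1 h2 S [convS /= subS].
have SO : S 0 by apply: subS; rewrite /= !inE eqxx.
have SX1 : S (ps, 0) by apply: subS; rewrite /= !inE eqxx !orbT.
have SX2 : S (0, ps) by apply: subS; rewrite /= !inE eqxx !orbT.
have SZ1 : S (a, b) by apply: subS; rewrite /= !inE eqxx !orbT.
have SZ2 : S (b, a) by apply: subS; rewrite /= !inE eqxx !orbT.
have a0 : 0 < a by apply: le_lt_trans ba.
have D0 : 0 < a ^+ 2 - b ^+ 2 by nra.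
have pairE (u1 u2 v1 v2 s t : R) : s * u1 + t * v1 = x -> s * u2 + t * v2 = y ->
    s *: (u1, u2) + t *: (v1, v2) = (x, y) by move=> <- <-.
have [below|above] := ltrP (a * y) (b * x).
  have bp : 0 < b by rewrite lt_neqAle b0 andbT; apply/negP => /eqP b0'; nra.
  (* The coordinates of the point along X1 and Z1; that their sum is at most [1] is the inequality
     of the edge X1Z1. *)
  rewrite -(pairE ps 0 a b ((x - y * a / b) / ps) (y / b)).
  - apply: convex_set_cone => //.
    + by rewrite divr_ge0 ?(ltW ps0)// subr_ge0 ler_pdivrMr//; nra.
    + exact: divr_ge0.
    + rewrite -(ler_pM2r (mulr_gt0 ps0 bp)).
      have -> : ((x - y * a / b) / ps + y / b) * (ps * b) = b * x + (ps - a) * y.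
        by field; rewrite !gt_eqF.
      by rewrite mul1r.
  - by field; rewrite !gt_eqF.
  - by field; rewrite !gt_eqF.
have [above'|below'] := ltrP (a * x) (b * y).
  have bp : 0 < b by rewrite lt_neqAle b0 andbT; apply/negP => /eqP b0'; nra.
  rewrite -(pairE 0 ps b a ((y - x * a / b) / ps) (x / b)).
  - apply: convex_set_cone => //.
    + by rewrite divr_ge0 ?(ltW ps0)// subr_ge0 ler_pdivrMr//; nra.
    + exact: divr_ge0.
    + rewrite -(ler_pM2r (mulr_gt0 ps0 bp)).
      have -> : ((y - x * a / b) / ps + x / b) * (ps * b) = (ps - a) * x + b * y.
        by field; rewrite !gt_eqF.
      by rewrite mul1r.
  - by field; rewrite !gt_eqF.
  - by field; rewrite !gt_eqF.
(* Cramer's rule between the rays through Z1 and Z2; the two coefficients add up to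
   [(x + y) / (a + b)]. *)
rewrite -(pairE a b b a ((a * x - b * y) / (a ^+ 2 - b ^+ 2))
                        ((a * y - b * x) / (a ^+ 2 - b ^+ 2))).
- apply: convex_set_cone => //.
  + by rewrite divr_ge0 ?(ltW D0)// subr_ge0.
  + by rewrite divr_ge0 ?(ltW D0)// subr_ge0.
  + rewrite -mulrDl ler_pdivrMr// mul1r; nra.
- by field; rewrite gt_eqF.
- by field; rewrite gt_eqF.
Qed.

End Hull.

(** * Throughput inequalities, time sharing and the sum capacity *)

Section CapacityBounds.
Variables (R : realType) (p r : R) (d : nat).
Local Notation state := {ffun 'I_2 -> bool}.
Hypothesis (p_ge0 : 0 <= p) (p_le1 : p <= 1) (r_ge0 : 0 <= r) (r_le1 : r <= 1).
Hypothesis (r_lt_p : r < p) (pr_lt1 : p - r < 1).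
Local Notation ps := (p_s p r).
Local Notation Tdp := (Tpow p r d p).
Local Notation Tdr := (Tpow p r d r).
Local Notation Csum := (ps * Tdp + (1 - ps) * ps).
Local Notation genie := (genie_sum d p r).

Lemma Tdr_ge : r <= Tdr. Proof. exact/Tpow_ge/ltW. Qed.

Lemma Tdr_lt_Tdp : Tdr < Tdp.
Proof. by rewrite -subr_gt0 Tpow_gap exprn_gt0// subr_gt0. Qed.

(** Condition on the first user: if it is OFF, what remains is the mean forecast of the second,
    which is [ps] by stationarity. *)
Lemma genie_sum_mean : stationary_mean p r genie = Csum.
Proof.
rewrite (stationary_meanE p r (fun b b' => if b || b' then Tdp else Tdr)).
rewrite !big_bool /=; move: (Tpow_stationary pr_lt1 d).
move: ps Tdp Tdr => q u v e.
by transitivity (q * u + (1 - q) * (q * u + (1 - q) * v)); [ring | rewrite e].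
Qed.

Lemma throughput_ge0 A i mu : is_throughput p r d A i mu -> 0 <= mu.
Proof.
move=> h; apply: (ler_cvg_to (cvg_cst 0) h); apply: nearW => m.
rewrite user_rateE// divr_ge0//; apply: sumr_ge0 => k _; exact: success_prob_ge0.
Qed.

Lemma throughput_genie A x y (c0 c1 : R) (G : state -> R) :
  is_throughput p r d A 0 x -> is_throughput p r d A 1 y ->
  0 <= c0 -> 0 <= c1 -> (forall s, 0 <= G s) ->
  (forall s : state, c0 * Tpow p r d (next_on p r (s 0)) <= G s) ->
  (forall s : state, c1 * Tpow p r d (next_on p r (s 1)) <= G s) ->
  c0 * x + c1 * y <= stationary_mean p r G.
Proof.
move=> hx hy c0_ge0 c1_ge0 G0 G1 G2.
pose c (i : 'I_2) := if i == 0 then c0 else c1.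
apply: (@cvg_le_divn _ (fun m => c0 * user_rate p r d A 0 m + c1 * user_rate p r d A 1 m)
   _ _ (d.+1%:R * \sum_i c i)).
  exact: (cvgD (cvgM (cvg_cst c0) hx) (cvgM (cvg_cst c1) hy)).
move=> m; apply: (@genie_bound _ _ _ _ _ _ _ _ _ A m c G) => //.
  by move=> i; rewrite /c; case: ifP.
move=> s i; rewrite /c; case: (eqVneq i 0) => [->//|/ord2_neq0 ->] //.
Qed.

Lemma Tpow_next_on_le b : Tpow p r d (next_on p r b) <= Tdp.
Proof. by case: b => //=; exact/ltW/Tdr_lt_Tdp. Qed.

Lemma Tpow_next_on_ge b : Tdr <= Tpow p r d (next_on p r b).
Proof. by case: b => //=; exact/ltW/Tdr_lt_Tdp. Qed.

Lemma genie_sum_ge0 s : 0 <= genie s.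
Proof.
rewrite /genie_sum; case: ifP => _; last exact: le_trans r_ge0 Tdr_ge.
exact: le_trans (le_trans r_ge0 Tdr_ge) (ltW Tdr_lt_Tdp).
Qed.

Lemma genie_sum_ge (s : state) i : 1 * Tpow p r d (next_on p r (s i)) <= genie s.
Proof.
rewrite mul1r /genie_sum; case: ifP => [_|/negbT]; first exact: Tpow_next_on_le.
rewrite negb_or => /andP[/negbTE s0 /negbTE s1].
by case: (eqVneq i 0) => [->|/ord2_neq0 ->]; rewrite ?s0 ?s1.
Qed.

(** With these weights user [i] earns at least [Tdp * Tdr] and user [j] at most that, so the genie
    may always schedule [i], at mean value [Tdp * ps]. *)
Lemma throughput_edge A (i j : 'I_2) x y :
  is_throughput p r d A i x -> is_throughput p r d A j y -> i != j ->
  Tdp * x + Tdr * y <= ps * Tdp.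
Proof.
have Tdr0 : 0 <= Tdr := le_trans r_ge0 Tdr_ge.
have Tdp0 : 0 <= Tdp := le_trans Tdr0 (ltW Tdr_lt_Tdp).
have Gmean k : stationary_mean p r (fun s => Tdp * Tpow p r d (next_on p r (s k))) = ps * Tdp.
  have e := Tpow_stationary pr_lt1 d.
  case: (eqVneq k 0) => [->|/ord2_neq0 ->].
    rewrite (stationary_meanE p r (fun b _ => Tdp * Tpow p r d (next_on p r b))).
    rewrite !big_bool /=; move: ps Tdp Tdr e => q u v e.
    by transitivity (u * (q * u + (1 - q) * v)); [ring | rewrite e mulrC].
  rewrite (stationary_meanE p r (fun _ b => Tdp * Tpow p r d (next_on p r b))).
  rewrite !big_bool /=; move: ps Tdp Tdr e => q u v e.
  by transitivity (u * (q * u + (1 - q) * v)); [ring | rewrite e mulrC].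
have Gge0 k (s : state) : 0 <= Tdp * Tpow p r d (next_on p r (s k)).
  by rewrite mulr_ge0// (le_trans Tdr0)// Tpow_next_on_ge.
have Gge k l (s : state) : Tdr * Tpow p r d (next_on p r (s k)) <=
    Tdp * Tpow p r d (next_on p r (s l)).
  rewrite (@le_trans _ _ (Tdr * Tdp))//; first by rewrite ler_wpM2l// Tpow_next_on_le.
  by rewrite mulrC ler_wpM2l// Tpow_next_on_ge.
move=> hx hy; case: (eqVneq i 0) hx => [->|/ord2_neq0 ->] hx;
  case: (eqVneq j 0) hy => [->|/ord2_neq0 ->] hy; rewrite ?eqxx// => _.
  rewrite -(Gmean 0).
  exact: (throughput_genie hx hy Tdp0 Tdr0 (Gge0 0) (fun=> lexx _) (Gge 1 0)).
rewrite -(Gmean 1) addrC.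
exact: (throughput_genie hy hx Tdr0 Tdp0 (Gge0 1) (Gge 0 1) (fun=> lexx _)).
Qed.

Lemma throughput_sum_le A x y :
  is_throughput p r d A 0 x -> is_throughput p r d A 1 y -> x + y <= Csum.
Proof.
move=> hx hy; rewrite -genie_sum_mean -[x]mul1r -[y]mul1r.
exact: (throughput_genie hx hy ler01 ler01 genie_sum_ge0
  (fun s => genie_sum_ge s 0) (fun s => genie_sum_ge s 1)).
Qed.

Lemma time_sharing_throughput (c : 'I_2 -> R) (gamma : R) :
  0 <= gamma -> gamma <= 1 -> (forall i, 0 <= c i) -> \sum_i c i <= 1 ->
  exists A, forall i, is_throughput p r d A i
    (gamma * (Csum / 2) + (1 - gamma) * (c i * ps)).
Proof.
(* Rules may depend on the horizon, so a fraction [gamma] of it, rounded down, is reserved for the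
   greedy rule at the end. *)
move=> g0 g1 c_ge0 c_le1; pose n m := Num.truncn (gamma * m%:R).
exists (greedy_policy d n c_ge0 c_le1) => i; rewrite -genie_sum_mean.
have gm0 m : 0 <= gamma * m%:R by rewrite mulr_ge0.
apply: greedy_throughput => // m; rewrite /n.
  rewrite truncn_le_nat (le_lt_trans (y := m%:R))// ?ler_piMl//.
  by rewrite ltr_nat.
have := truncn_le (gamma * m%:R); rewrite gm0 => le_g.
have := truncnS_gt (gamma * m%:R); rewrite -natr1 => lt_g.
by rewrite ler_distl; apply/andP; split; lra.
Qed.

Lemma sum_capacity : is_sum_capacity p r d Csum.
Proof.
have sumE A : sum_rate p r d A =
    (fun m => user_rate p r d A 0 m + user_rate p r d A 1 m).
  by apply/funext => m; exact: sum_rateE.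
split.
  have [A hA] := @time_sharing_throughput (fun=> 0) 1 ler01 (lexx 1)
    (fun=> lexx 0) (eq_ind_r (fun x => x <= 1) ler01 (big1_eq _ _)).
  exists A; rewrite /is_sum_throughput sumE.
  have -> : Csum = Csum / 2 + Csum / 2 by rewrite -splitr.
  have {}hA i : is_throughput p r d A i (Csum / 2).
    by move: (hA i); rewrite mul1r subrr mul0r addr0.
  exact: (cvgD (hA 0) (hA 1)).
(* Only the sum of the rates is known to converge, so the genie bound is applied at each finite
   horizon before passing to the limit. *)
move=> A c'; rewrite /is_sum_throughput sumE => hc'.
apply: (cvg_le_divn hc') => m; rewrite -genie_sum_mean.
rewrite -[user_rate _ _ _ _ 0 _]mul1r -[user_rate _ _ _ _ 1 _]mul1r.
apply: (@genie_bound _ _ _ _ _ _ _ _ _ A m (fun=> 1) genie) => //.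
  exact: genie_sum_ge0.
exact: genie_sum_ge.
Qed.

End CapacityBounds.

Theorem corollary11 (R : realType) (p r : R) (d : nat)
    (p_ge0 : 0 <= p) (p_le1 : p <= 1) (r_ge0 : 0 <= r) (r_le1 : r <= 1)
    (r_lt_p : r < p) (pr_lt2 : p + (1 - r) < 2) :
  let ps := p_s p r in
  let Tdp := Tpow p r d p in
  let Tdr := Tpow p r d r in
  let O := (0, 0) in
  let X1 := (ps, 0) in
  let X2 := (0, ps) in
  let Z1 := (ps * Tdp + (1 - ps) ^+ 2 * Tdr, (1 - ps) * ps * Tdp) in
  let Z2 := ((1 - ps) * ps * Tdp, ps * Tdp + (1 - ps) ^+ 2 * Tdr) in
  let Csum := ps * Tdp + (1 - ps) * ps in
  let Y12 := (Csum / 2, Csum / 2) in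
  [/\ capacity_region p r d `<=` hull [:: O; X1; Z1; Z2; X2],
      hull [:: O; X1; Y12; X2] `<=` capacity_region p r d
    & is_sum_capacity p r d Csum].
Proof.
have pr_lt1 : p - r < 1 by lra.
move=> ps Tdp Tdr O X1 X2 Z1 Z2 Csum Y12; split; last exact: sum_capacity.
  move=> [x y] [A [/= hx hy]].
  have x0 := throughput_ge0 p_ge0 p_le1 r_ge0 r_le1 pr_lt1 hx.
  have y0 := throughput_ge0 p_ge0 p_le1 r_ge0 r_le1 pr_lt1 hy.
  have sum_le := throughput_sum_le p_ge0 p_le1 r_ge0 r_le1 r_lt_p pr_lt1 hx hy.
  have e1 := throughput_edge p_ge0 p_le1 r_ge0 r_le1 r_lt_p pr_lt1 hx hy isT.
  have e2 := throughput_edge p_ge0 p_le1 r_ge0 r_le1 r_lt_p pr_lt1 hy hx isT.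
  have st := Tpow_stationary pr_lt1 d.
  have ps0 := p_s_ge0 r_ge0 pr_lt1.
  have ps1 := p_s_le1 p_le1 pr_lt1.
  have Tr := Tdr_ge d r_ge0 r_lt_p.
  have Tpr := Tdr_lt_Tdp d r_lt_p.
  rewrite -/ps -/Tdp -/Tdr in sum_le e1 e2 st ps0 ps1 Tr Tpr.
  (* For [r = 0] the stationary probability vanishes and the sum bound leaves only the origin;
     [pentagon_hull] is for positive [ps]. *)
  have [r0|r0] := eqVneq r 0.
    have ps_eq0 : ps = 0 by rewrite /ps /p_s r0 mul0r.
    rewrite ps_eq0 in sum_le.
    have [-> ->] : x = 0 /\ y = 0 by split; lra.
    by apply: sub_gen_smallest; rewrite /= !inE eqxx.
  have rp : 0 < r by rewrite lt_neqAle eq_sym r0.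
  have psp : 0 < ps by rewrite /ps /p_s divr_gt0// subr_gt0.
  have Tdp0 : 0 <= Tdp by rewrite (le_trans r_ge0)// (le_trans Tr)// ltW.
  have pps : 0 <= ps * (1 - ps) by rewrite mulr_ge0// subr_ge0.
  clear hx hy A; clearbody ps Tdp Tdr.
  (* Hence the edges X1Z1 and Z2X2 are [e1] and [e2] scaled by [ps * (1 - ps)], which explains the
     choice of the genie weights. *)
  have gap : ps - (ps * Tdp + (1 - ps) ^+ 2 * Tdr) = ps * (1 - ps) * Tdr.
    by rewrite -{1}st; ring.
  apply: pentagon_hull => //.
  - by rewrite !mulr_ge0// subr_ge0.
  - have -> : ps * Tdp + (1 - ps) ^+ 2 * Tdr =
      (1 - ps) * ps * Tdp + (ps ^+ 2 * Tdp + (1 - ps) ^+ 2 * Tdr) by ring.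
    rewrite ltrDl ltr_wpDr ?mulr_ge0 ?exprn_ge0 ?subr_ge0 ?(le_trans r_ge0)//.
    by rewrite mulr_gt0 ?exprn_gt0// (lt_trans rp)// (le_lt_trans Tr).
  - apply: le_trans sum_le _; rewrite le_eqVlt; apply/orP; left; apply/eqP.
    by rewrite /Csum -{3}st; ring.
  - rewrite gap; have := ler_wpM2l pps e1; lra.
  - rewrite gap; nra.
(* The inner hull by explicit weights on X1, X2 and Y12, the remaining weight being on the
   origin. *)
pose D : set (R * R) := [set z | exists al be ga : R, [/\ 0 <= al, 0 <= be, 0 <= ga,
  al + be + ga <= 1 & z = (al * ps + ga * (Csum / 2), be * ps + ga * (Csum / 2))]].
apply: (@subset_trans _ D).
  apply: smallest_sub.
    move=> z1 z2 t; rewrite !inE => -[a1 [b1 [g1 [a10 b10 g10 s1 ->]]]].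
    move=> [a2 [b2 [g2 [a20 b20 g20 s2 ->]]]].
    have [t0 t1] : 0 <= t%:num /\ 0 <= 1 - t%:num by split; rewrite ?subr_ge0.
    exists (t%:num * a1 + (1 - t%:num) * a2), (t%:num * b1 + (1 - t%:num) * b2),
      (t%:num * g1 + (1 - t%:num) * g2); split; rewrite ?addr_ge0 ?mulr_ge0//.
      by nra.
    have mixE (u q h x1 x2 y1 y2 : R) :
        u * (x1 * q + y1 * h) + (1 - u) * (x2 * q + y2 * h) =
        (u * x1 + (1 - u) * x2) * q + (u * y1 + (1 - u) * y2) * h by ring.
    by congr (_, _); exact: mixE.
  move=> z; rewrite /= !inE => /or4P[] /eqP ->.
  - by exists 0, 0, 0; split; rewrite ?mul0r ?addr0.
  - by exists 1, 0, 0; split; rewrite ?mul0r ?mul1r ?addr0.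
  - by exists 0, 0, 1; split; rewrite ?mul0r ?mul1r ?add0r.
  - by exists 0, 1, 0; split; rewrite ?mul0r ?mul1r ?addr0 ?add0r.
move=> z [al [be [ga [al0 be0 ga0 s1 ->]]]].
(* The memoryless choice runs for a fraction [1 - ga] of the time, hence the normalization. For
   [ga = 1] division by zero gives [0], which is right since then [al = be = 0]. *)
pose c (i : 'I_2) := (if i == 0 then al else be) / (1 - ga).
have c0 i : 0 <= c i by rewrite /c divr_ge0//; [case: ifP | lra].
have c1 : \sum_i c i <= 1.
  rewrite big_ord2 /c /= -mulrDl; have [->|g1] := eqVneq ga 1.
    by rewrite subrr invr0 mulr0.
  by rewrite ler_pdivrMr ?subr_gt0 ?lt_neqAle ?g1//; lra.
have ga1 : ga <= 1 by lra.
have [A hA] := time_sharing_throughput d p_ge0 p_le1 r_ge0 r_le1 pr_lt1 ga0 ga1 c0 c1.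
have cE i : (1 - ga) * c i = if i == 0 then al else be.
  rewrite /c; have [g1|g1] := eqVneq ga 1.
    by rewrite g1 subrr mul0r; case: ifP => _; lra.
  by rewrite mulrC divfK// subr_eq0 eq_sym.
exists A; split; rewrite /= addrC; [move: (hA 0)|move: (hA 1)];
  by rewrite [(1 - ga) * _]mulrA cE.
Qed.
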